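(* Let $d \geq 1$ be an integer, let $(\vec{z}_n)_{n \in \mathbb{N}}$ be a low-discrepancy sequence in $[0,1]^d$, let $\varepsilon > 0$, and let $(\vec{X}_n)_{n \in \mathbb{N}}$ be a sequence of independent random vectors which are uniformly distributed on $[0,1]^{d}$. For arbitrary $s>0$, let $F_{N,d}(s)$ be the pair correlation function of the sequence $(\vec{Y}_n)_{n \in \mathbb{N}} = (\{\vec{z}_n + \varepsilon \vec{X}_n\})_{n \in \mathbb{N}}$. Then the expected value $\mathbb{E}[F_{N,d}(s)]$ converges to $(2s)^d$ as $N \to \infty$.
   Context: $\mathbb{N} = \{1,2,3,\ldots\}$. The discrepancy of a sequence $(x_n)_{n \in \mathbb{N}}$ is $$D_N(x_n) := \sup_{B} \left| \frac{1}{N}\# \left\{1 \leq i \leq N : x_i \in B \right\} - \lambda_d(B) \right|,$$ where the supremum is taken over all boxes $B = [a_1,b_1) \times \ldots \times [a_d,b_d) \subset [0,1)^{d}$ and $\lambda_d$ denotes the $d$-dimensional Lebesgue measure. The sequence is called a low-discrepancy sequence if $D_N(x_n) = \mathcal{O}(N^{-1}(\log N)^{d})$ as $N \to \infty$. $\{\cdot\}$ denotes the fractional part of a real number, and is applied component-wise to vectors. For $x \in \mathbb{R}$, $\|x\|$ denotes the distance of $x$ to its nearest integer, and for $x = (x_1,\ldots,x_d) \in \mathbb{R}^d$ one sets $\|x\|_\infty := \max(\|x_1\|,\ldots,\|x_d\|)$. For a sequence $(x_n)_{n\in\mathbb{N}}$ in $[0,1)^d$, $N \in \mathbb{N}$ and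 $s > 0$, the pair correlation function is $$F_{N,d}(s) := \frac{1}{N} \# \left\{ (k,l) : 1 \leq k \neq l \leq N, \ \left\| x_k - x_l\right\|_{\infty} \leq \frac{s}{N^{1/d}} \right\}.$$ *)

(* Defs.v *)
From HB Require Import structures.
From mathcomp Require Import all_boot all_order all_algebra finmap.
From mathcomp Require Import all_classical all_reals all_analysis.

Set Implicit Arguments.
Unset Strict Implicit.
Unset Printing Implicit Defensive.

Import Order.TTheory GRing.Theory Num.Theory.
Import numFieldNormedType.Exports.

Local Open Scope classical_set_scope.
Local Open Scope ring_scope.

(* Points of R^d are d.-tuples, since MathComp-Analysis provides the product
   (Borel) sigma-algebra on tuples.  Sequences (x_n)_{n >= 1} are functions on
   nat, with x_{n+1} encoded as x n; hence the first N terms x_1, ..., x_N are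
   the x i with i : 'I_N. *)

Section lebesgue_cons.
Context {R : realType} {n : nat}.
Variable mu : {sigma_finite_measure set (n.-tuple R) -> \bar R}.

Let consp (x : measurableTypeR R * n.-tuple R) : n.+1.-tuple R :=
  [tuple of x.1 :: x.2].

Let measurable_consp : measurable_fun [set: _] consp.
Proof. by apply: measurable_cons; [exact: measurable_fst|]. Qed.

Definition lebesgue_cons : set (n.+1.-tuple R) -> \bar R :=
  pushforward (lebesgue_measure \x mu)%E consp.

Let nu : {measure set (n.+1.-tuple R) -> \bar R} :=
  measure_function_pushforward__canonical__measure_function_Measure
    (lebesgue_measure \x mu)%E measurable_consp.

Let lebesgue_cons0 : lebesgue_cons set0 = 0%E.
Proof. exact: (measure0 nu). Qed.

Let lebesgue_cons_ge0 A : (0 <= lebesgue_cons A)%E.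
Proof. exact: (measure_ge0 nu). Qed.

Let lebesgue_cons_sigma_additive : semi_sigma_additive lebesgue_cons.
Proof. exact: (@measure_semi_sigma_additive _ _ _ nu). Qed.

HB.instance Definition _ := isMeasure.Build _ _ _ lebesgue_cons
  lebesgue_cons0 lebesgue_cons_ge0 lebesgue_cons_sigma_additive.

Let lebesgue_cons_sigma_finite : sigma_finite [set: _] lebesgue_cons.
Proof.
have /sigma_finiteP[F [TF ndF Foo]] := sigma_finiteT (@lebesgue_measure R).
have /sigma_finiteP[G [TG ndG Goo]] := sigma_finiteT mu.
exists (fun k => [set t : n.+1.-tuple R | F k (thead t) /\
                                         G k [tuple of behead t]]).
  apply/esym; rewrite -subTset => t _.
  have [i _ Fi] : (\bigcup_k F k) (thead t) by rewrite -TF.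
  have [j _ Gj] : (\bigcup_k G k) [tuple of behead t] by rewrite -TG.
  exists (maxn i j) => //; split.
  - by move: Fi; exact/subsetPset/ndF/leq_maxl.
  - by move: Gj; exact/subsetPset/ndG/leq_maxr.
move=> k; have [mF Fk] := Foo k; have [mG Gk] := Goo k; split.
  apply: measurableI.
  - by rewrite -[X in measurable X]setTI; exact: (measurable_tnth ord0).
  - by rewrite -[X in measurable X]setTI; exact: measurable_behead.
rewrite (_ : lebesgue_cons _ = (lebesgue_measure \x mu)%E (F k `*` G k)).
  by rewrite product_measure1E// lte_mul_pinfty// ge0_fin_numE.
congr product_measure1; apply/funext => -[x t]; rewrite /= theadE.
by congr (_ /\ G k _); apply/val_inj.
Qed.

HB.instance Definition _ := Measure_isSigmaFinite.Build _ _ _ lebesgue_cons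
  lebesgue_cons_sigma_finite.

End lebesgue_cons.

(* The d-dimensional Lebesgue measure on the Borel sets of R^d:
   lambda_0 is the unit mass at the empty tuple, and lambda_(n+1) is the
   product measure lambda_1 \x lambda_n, transported along R * R^n = R^(n+1). *)
Fixpoint lebesgue_tuple {R : realType} (d : nat) :
    {sigma_finite_measure set (d.-tuple R) -> \bar R} :=
  if d is n.+1 then lebesgue_cons (lebesgue_tuple n) else \d_[tuple].

Section discrepancy.
Context {R : realType} {d : nat}.
Implicit Types (x : nat -> d.-tuple R) (N : nat).

Definition box (a b : d.-tuple R) : set (d.-tuple R) :=
  [set t | forall i, tnth a i <= tnth t i < tnth b i].

Definition half_open_cube : set (d.-tuple R) :=
  [set t | forall i, 0 <= tnth t i < 1].

Definition closed_cube : set (d.-tuple R) :=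
  [set t | forall i, 0 <= tnth t i <= 1].

Definition count_in x N (B : set (d.-tuple R)) : nat :=
  #|[pred i : 'I_N | x i \in B]|.

Definition discrepancy x N : R :=
  sup [set `|(count_in x N (box ab.1 ab.2))%:R / N%:R
             - fine (lebesgue_tuple d (box ab.1 ab.2))|
      | ab in [set ab | box ab.1 ab.2 `<=` half_open_cube]].

Definition low_discrepancy x : Prop :=
  discrepancy x =O_\oo (fun N => N%:R^-1 * (ln N%:R) ^+ d).

End discrepancy.

Section pair_correlation.
Context {R : realType}.

Definition frac_part (r : R) : R := r - (Num.floor r)%:~R.

Definition dist_int (r : R) : R := inf [set `|r - k%:~R| | k in [set: int]].

Context {d : nat}.

(* ||x - y||_oo; the default value 0 of the maximum is harmless, all the
   terms being nonnegative. *)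
Definition torus_dist (x y : d.-tuple R) : R :=
  \big[Num.max/0]_(i < d) dist_int (tnth x i - tnth y i).

Definition pair_correlation (x : nat -> d.-tuple R) (N : nat) (s : R) : R :=
  #|[pred kl : 'I_N * 'I_N | (kl.1 != kl.2) &&
      (torus_dist (x kl.1) (x kl.2) <= s / (N%:R `^ d%:R^-1))]|%:R / N%:R.

Definition frac_shift (eps : R) (z x : d.-tuple R) : d.-tuple R :=
  [tuple frac_part (tnth z i + eps * tnth x i) | i < d].

End pair_correlation.

Section random_vectors.
Context {disp disp' : measure_display} {T : measurableType disp}
  {T' : measurableType disp'} {R : realType} (P : probability T R).

Definition independent_RVs (X : nat -> {RV P >-> T'}) : Prop :=
  forall (J : {fset nat}) (A : nat -> set T'),
    (forall j, j \in J -> measurable (A j)) ->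
    P (\bigcap_(j in [set` J]) X j @^-1` A j) =
    (\prod_(j <- J) P (X j @^-1` A j))%E.

End random_vectors.

Definition uniform_on_cube {disp : measure_display} {T : measurableType disp}
    {R : realType} (P : probability T R) (d : nat)
    (X : {RV P >-> d.-tuple R}) : Prop :=
  forall A : set (d.-tuple R), measurable A ->
    distribution P X A = lebesgue_tuple d (A `&` closed_cube).

(* Main.v *)
(* Condition on X_l and put y = z_l + eps X_l.  With delta = s / N^(1/d), the
   probability that the torus distance of Y_k to y is at most delta is the
   product over the coordinates i of h(z_k,i - y_i), where h(t) is the length of
   {u in [0,1] : ||t + eps u|| <= delta}, i.e. eps^-1 times the length that the
   interval [t, t + eps] cuts out of the 1-periodic set {||.|| <= delta}, whose
   length per period is 2 delta.  Split [0,1] into M equal cells.  On each cell,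
   h(. - y_i) lies between two multiples of lengths of runs of consecutive cells,
   and by periodicity these bounds average over the M cells to
   2 delta (1 + O(1/(eps M))).  Since the
   discrepancy D_N tends to 0, the z_k are equidistributed among the M^d product
   cells, so (1/N) sum_k prod_i h(z_k,i - y_i) is
   (2 delta)^d ((1 + O(1/(eps M)))^d + O_M(D_N)), uniformly in y.  Multiplying by
   N turns (2 delta)^d into (2 s)^d, and the excluded term k = l is O_M(1/N).
   Let N tend to infinity, then M. *)

Require Import Defs.
From HB Require Import structures.
From mathcomp Require Import all_boot all_order all_algebra finmap.
From mathcomp Require Import all_classical all_reals all_analysis measurable_realfun.
From mathcomp Require Import ring lra zify.

Set Implicit Arguments.
Unset Strict Implicit.
Unset Printing Implicit Defensive.

Import Order.TTheory GRing.Theory Num.Theory.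
Import numFieldNormedType.Exports.

Local Open Scope classical_set_scope.
Local Open Scope ring_scope.

(** * Length of a periodic set in an interval *)

(** [c] times the image of Lebesgue measure under [u |-> t + c * u] gives each []a, b]] its length,
    so uniqueness of Lebesgue measure applies. *)
Lemma lebesgue_measure_affine (R : realType) (c t : R) (B : set R) :
  0 < c -> measurable B ->
  lebesgue_measure ((fun u => t + c * u) @^-1` B) = (c^-1%:E * lebesgue_measure B)%E.
Proof.
move=> c0 mB.
pose f (u : measurableTypeR R) : measurableTypeR R := t + c * u.
have mf : measurable_fun [set: measurableTypeR R] f.
  by apply: measurable_funD => //; exact: measurable_funM.
pose mu : {measure set (measurableTypeR R) -> \bar R} := mscale (NngNum (ltW c0))
  (measure_function_pushforward__canonical__measure_function_Measure
    lebesgue_measure mf).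
rewrite (@lebesgue_measure_unique R mu _ B mB).
  by rewrite /mu /mscale/= muleA -EFinM mulVf ?gt_eqF// mul1e.
move=> _ [[a b] _ <-].
have E : f @^-1` `]a, b]%classic = `](a - t) / c, (b - t) / c]%classic.
  apply/seteqP; split => u /=; rewrite /f !in_itv/= ltr_pdivrMr// ler_pdivlMr// => /andP[h1 h2];
  apply/andP; split; rewrite (mulrC u) in h1 h2 *; lra.
have -> : mu `]a, b]%classic =
    (c%:E * lebesgue_measure `]((a - t) / c)%R, ((b - t) / c)%R]%classic)%E.
  by rewrite -E.
rewrite !lebesgue_measure_itv/= !lte_fin ltr_pM2r ?invr_gt0// ltrD2r.
case: ifPn => ab; last by rewrite mule0.
by rewrite -!EFinB -EFinM; congr EFin; field; rewrite gt_eqF.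
Qed.

(** Rounding gives an integer within [1/2] of [r]; any other integer is at distance at least 1 from
    it, hence at least [1/2] from [r]. The infimum thus becomes a formula that can be measured and
    computed. *)
Lemma dist_intE (R : realType) (r : R) :
  dist_int r = `|r - (Num.floor (r + 2^-1))%:~R|.
Proof.
rewrite /dist_int; set k := Num.floor _.
have /andP[k1 k2] := floor_itv (r + 2^-1).
rewrite -/k intrD in k1 k2.
apply/eqP; rewrite eq_le; apply/andP; split.
  apply: ge_inf; last by exists k.
  by exists 0 => _ [m _ <-].
apply: lb_le_inf; first by exists `|r - k%:~R|, k.
move=> _ [m _ <-].
have [->//|mk] := eqVneq m k.
have h : 1 <= `|m%:~R - k%:~R : R|.
  by rewrite -intrB -intr_norm ler1z -gtz0_ge1 normr_gt0 subr_eq0.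
have h2 : `|r - k%:~R| <= 2^-1 by rewrite ler_norml; lra.
have := ler_distD r m%:~R k%:~R; rewrite (distrC m%:~R r).
by lra.
Qed.

Lemma dist_intD (R : realType) (r : R) (k : int) : dist_int (r + k%:~R) = dist_int r.
Proof.
rewrite !dist_intE [r + _ + 2^-1]addrAC floorDrz ?intr_int// intrKfloor.
rewrite intrD; congr `|_|; ring.
Qed.

Lemma measurable_dist_int (R : realType) : measurable_fun [set: R] (@dist_int R).
Proof.
rewrite (_ : @dist_int R = fun r => `|r - (Num.floor (r + 2^-1))%:~R|); last first.
  by apply/funext => r; exact: dist_intE.
apply: measurableT_comp => //; apply: measurable_funB => //.
apply: nondecreasing_measurable => // x y xy.
by rewrite ler_int floor_ge_int (le_trans (floor_le _))// lerD2r.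
Qed.

Lemma dist_int_ball (R : realType) (delta : R) : 0 <= delta < 2^-1 ->
  [set r | dist_int r <= delta] `&` `[- 2^-1, 2^-1[%classic = `[- delta, delta]%classic.
Proof.
move=> /andP[d0 d1]; apply/seteqP; split => r /=; rewrite !in_itv/= dist_intE.
  move=> [+ /andP[h1 h2]].
  by rewrite (@floor_def _ _ 0) ?subr0 ?ler_norml//; apply/andP; split; lra.
move=> /andP[h1 h2]; split; last by apply/andP; split; lra.
rewrite (@floor_def _ _ 0) ?subr0 ?ler_norml//; apply/andP; split; lra.
Qed.

Section periodic_set.
Context {R : realType}.
Variable A : set R.
Hypothesis mA : measurable A.
Hypothesis perA : forall (x : R) (k : int), A (x + k%:~R) <-> A x.

Definition mass (a b : R) : R := fine (lebesgue_measure (A `&` `[a, b[%classic)).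

Let massE a b : lebesgue_measure (A `&` `[a, b[%classic) = (mass a b)%:E.
Proof.
rewrite /mass fineK// ge0_fin_numE//.
apply: (@le_lt_trans _ _ (lebesgue_measure `[a, b[%classic)).
  by apply: le_measure; rewrite ?inE//; exact: measurableI.
by rewrite lebesgue_measure_itv/=; case: ifPn => _; rewrite ?ltry// -EFinB ltry.
Qed.

Lemma mass_ge0 a b : 0 <= mass a b.
Proof. by rewrite fine_ge0. Qed.

Lemma mass_split a b c : a <= b -> b <= c -> mass a c = mass a b + mass b c.
Proof.
move=> ab bc; apply: EFin_inj; rewrite EFinD -!massE -measureU//; first last.
- apply/seteqP; split => x //= -[[_]]; rewrite !in_itv/= => /andP[_ h1] [_ /andP[h2 _]].
  by move: (lt_le_trans h1 h2); rewrite ltxx.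
- exact: measurableI.
- exact: measurableI.
congr lebesgue_measure; rewrite -setIUr; congr setI.
apply/seteqP; split => x /=; rewrite !in_itv/=.
  by move=> /andP[h1 h2]; case: (ltP x b) => h; [left|right]; rewrite ?h1 ?h2.
by move=> [|] /andP[h1 h2]; apply/andP; split => //; [exact: lt_le_trans bc|exact: le_trans h1].
Qed.

Lemma massxx a : mass a a = 0.
Proof. by rewrite /mass set_itvE setI0 measure0. Qed.

Lemma mass_shift a b (k : int) : mass (a + k%:~R) (b + k%:~R) = mass a b.
Proof.
apply: EFin_inj; rewrite -!massE.
rewrite -[LHS]mul1e -[X in (X%:E * _)%E]invr1 -(@lebesgue_measure_affine _ _ k%:~R)//; last first.
  exact: measurableI.
congr lebesgue_measure; apply/seteqP; split => x /=;
  rewrite mul1r (addrC _ x) !in_itv/= lerD2r ltrD2r => -[h1 h2]; split => //.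
  exact/(perA x k).
exact/(perA x k).
Qed.

(** The interval [[a, a + 1[] contains or ends at a half-integer [2^-1 + k]. Cutting there and
    moving the right piece back by 1 gives the standard period translated by [k]. *)
Lemma mass_period a : mass a (a + 1) = mass (- 2^-1) 2^-1.
Proof.
set k := Num.floor (a + 2^-1).
have /andP[k1 k2] := floor_itv (a + 2^-1); rewrite -/k intrD in k1 k2.
have h1 : a <= 2^-1 + k%:~R by lra.
have h2 : 2^-1 + k%:~R <= a + 1 by lra.
have h3 : - 2^-1 + k%:~R <= a by lra.
rewrite (mass_split h1 h2) -(mass_shift (- 2^-1) 2^-1 k) (mass_split h3 h1) addrC.
congr (_ + _); rewrite -[RHS](mass_shift _ _ 1); congr mass; lra.
Qed.

Lemma mass_sum (f : nat -> R) n m : {homo f : x y / (x <= y)%N >-> x <= y} ->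
  mass (f n) (f (n + m)%N) = \sum_(i < m) mass (f (n + i)%N) (f (n + i).+1).
Proof.
move=> fh; elim: m => [|m ih]; first by rewrite addn0 massxx big_ord0.
rewrite big_ord_recr/= -ih addnS; apply: mass_split; apply: fh => //.
exact: leq_addr.
Qed.

Variable M : nat.
Hypothesis M0 : (0 < M)%N.

(** The translation by [-y] matches the argument [z - y] of [hit]. The index [m] may exceed [M]:
    runs of cells leave the unit interval, and periodicity accounts for the overhang. *)
Definition cell_mass (y : R) (m : nat) : R := mass (m%:R / M%:R - y) (m.+1%:R / M%:R - y).

Lemma cell_mass_ge0 y m : 0 <= cell_mass y m.
Proof. exact: mass_ge0. Qed.

Let homo_grid y : {homo (fun m : nat => m%:R / M%:R - y : R) : x y / (x <= y)%N >-> x <= y}.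
Proof. by move=> a b ab /=; rewrite lerD2r ler_wpM2r ?invr_ge0// ler_nat. Qed.

Lemma sum_cell_mass y n m :
  \sum_(i < m) cell_mass y (n + i)%N = mass (n%:R / M%:R - y) ((n + m)%N%:R / M%:R - y).
Proof. by rewrite (mass_sum _ _ (@homo_grid y)). Qed.

Lemma sum_cell_mass_period y n :
  \sum_(i < M) cell_mass y (n + i)%N = mass (- 2^-1) 2^-1.
Proof.
rewrite sum_cell_mass -(mass_period (n%:R / M%:R - y)); congr mass.
by rewrite natrD mulrDl divff ?pnatr_eq0 -?lt0n// addrAC.
Qed.

(** After exchanging the sums, each fixed offset [i] sees [M] consecutive cells, that is, one full
    period. *)
Lemma sum_cell_mass_window y n m :
  \sum_(a < M) \sum_(i < m) cell_mass y (n + a + i)%N = m%:R * mass (- 2^-1) 2^-1.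
Proof.
rewrite exchange_big/=.
under eq_bigr => i _ do (under eq_bigr => a _ do rewrite addnAC; rewrite sum_cell_mass_period).
by rewrite sumr_const card_ord mulr_natl.
Qed.

(** The run starting at [n] is the term [a = 0] of the nonnegative sum in [sum_cell_mass_window]. *)
Lemma sum_cell_mass_le y n m :
  \sum_(i < m) cell_mass y (n + i)%N <= m%:R * mass (- 2^-1) 2^-1.
Proof.
rewrite -(sum_cell_mass_window y n m) (bigD1 (Ordinal M0))//= addn0 lerDl.
by apply: sumr_ge0 => a _; apply: sumr_ge0 => i _; exact: cell_mass_ge0.
Qed.

Variable eps : R.
Hypothesis eps0 : 0 < eps.

(** The function h of the overview, for a general periodic set [A]. *)
Definition hit (t : R) : R :=
  fine (lebesgue_measure [set u | A (t + eps * u) /\ 0 <= u <= 1]).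

Let measurable_hit t : measurable [set u | A (t + eps * u) /\ 0 <= u <= 1].
Proof.
rewrite (_ : [set _ | _] = ((fun u => t + eps * u) @^-1` A) `&` `[0, 1]%classic); last first.
  by apply/seteqP; split => u /=; rewrite in_itv.
apply: measurableI => //; rewrite -[X in measurable X]setTI.
have : measurable_fun [set: R] (fun u => t + eps * u); last by apply.
by apply: measurable_funD => //; exact: measurable_funM.
Qed.

Lemma lebesgue_hit t :
  lebesgue_measure [set u | A (t + eps * u) /\ 0 <= u <= 1] = (hit t)%:E.
Proof.
rewrite /hit fineK// ge0_fin_numE//.
apply: (@le_lt_trans _ _ (lebesgue_measure `[0%R, 1%R]%classic)).
  apply: le_measure; rewrite ?inE; [exact: measurable_hit|by []|].
  by move=> u [_ ?] /=; rewrite in_itv.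
by rewrite lebesgue_measure_itv/=; case: ifPn => _; rewrite ?ltry// -EFinB ltry.
Qed.

Lemma hit_ge0 t : 0 <= hit t.
Proof. by rewrite fine_ge0. Qed.

Let preim_mass t a b :
  lebesgue_measure ((fun u => t + eps * u) @^-1` (A `&` `[a, b[%classic)) = (eps^-1 * mass a b)%:E.
Proof. by rewrite lebesgue_measure_affine ?massE//; exact: measurableI. Qed.

Let mpreim t a b : measurable ((fun u => t + eps * u) @^-1` (A `&` `[a, b[%classic)).
Proof.
rewrite -[X in measurable X]setTI.
have : measurable_fun [set: R] (fun u => t + eps * u).
  by apply: measurable_funD => //; exact: measurable_funM.
by apply => //; exact: measurableI.
Qed.

(** The bound on [t + eps] is strict because [[a, b[] has to contain that endpoint, reached at
    [u = 1]. *)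
Lemma hit_le t a b : a <= t -> t + eps < b -> hit t <= eps^-1 * mass a b.
Proof.
move=> ta tb; rewrite -lee_fin -lebesgue_hit -(preim_mass t).
apply: le_measure; rewrite ?inE; [exact: measurable_hit|exact: mpreim|].
move=> u /= [Au /andP[u0 u1]]; split => //.
rewrite in_itv/=; apply/andP; split; first by rewrite (le_trans ta)// lerDl mulr_ge0// ltW.
by rewrite (le_lt_trans _ tb)// lerD2l ler_piMr// ltW.
Qed.

Lemma hit_ge t a b : t <= a -> b <= t + eps -> eps^-1 * mass a b <= hit t.
Proof.
move=> ta tb; rewrite -lee_fin -lebesgue_hit -(preim_mass t).
apply: le_measure; rewrite ?inE; [exact: mpreim|exact: measurable_hit|].
move=> u /= [Au]; rewrite in_itv/= => /andP[u0 u1]; split => //.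
apply/andP; split; rewrite -(ler_pM2l eps0); lra.
Qed.

(* eps lies in [(window - 1) / M, window / M[, so translates of [0, eps] contain
   window - 2 and are covered by window + 1 consecutive cells of length 1 / M. *)
Definition window : nat := (Num.truncn (eps * M%:R)).+1.

Let windowP : window.-1%:R <= eps * M%:R < window%:R.
Proof.
by apply/andP; split; [rewrite truncn_le|rewrite truncnS_gt]; rewrite ?mulr_ge0// ltW.
Qed.

(** Here [a] is the cell of [z]. Since [z] may lie anywhere in it, the covering run starts with cell
    [a] itself and the contained run of [hit_lower] only with the next one. *)
Definition hit_upper (y : R) (a : nat) : R :=
  eps^-1 * \sum_(i < window.+1) cell_mass y (a + i)%N.

Definition hit_lower (y : R) (a : nat) : R :=
  eps^-1 * \sum_(i < window.-2) cell_mass y (a.+1 + i)%N.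

Lemma sum_hit_upper y :
  M%:R^-1 * \sum_(a < M) hit_upper y a =
  window.+1%:R / (eps * M%:R) * mass (- 2^-1) 2^-1.
Proof.
rewrite -mulr_sumr; under eq_bigr => a _ do rewrite -[nat_of_ord a]add0n.
by rewrite sum_cell_mass_window invfM; ring.
Qed.

Lemma sum_hit_lower y :
  M%:R^-1 * \sum_(a < M) hit_lower y a =
  window.-2%:R / (eps * M%:R) * mass (- 2^-1) 2^-1.
Proof.
rewrite -mulr_sumr; under eq_bigr => a _ do rewrite -[a.+1]add1n.
by rewrite sum_cell_mass_window invfM; ring.
Qed.

Lemma hit_upper_ge0 y a : 0 <= hit_upper y a.
Proof.
apply: mulr_ge0; first by rewrite invr_ge0 ltW.
by apply: sumr_ge0 => i _; exact: cell_mass_ge0.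
Qed.

Lemma hit_lower_ge0 y a : 0 <= hit_lower y a.
Proof.
apply: mulr_ge0; first by rewrite invr_ge0 ltW.
by apply: sumr_ge0 => i _; exact: cell_mass_ge0.
Qed.

Lemma hit_upper_le y a :
  hit_upper y a <= window.+1%:R / eps * mass (- 2^-1) 2^-1.
Proof.
by rewrite mulrAC mulrC ler_pM2l ?invr_gt0//; exact: sum_cell_mass_le.
Qed.

(** The constant is that of [hit_upper_le], so that one [K] serves both averages. *)
Lemma hit_lower_le y a :
  hit_lower y a <= window.+1%:R / eps * mass (- 2^-1) 2^-1.
Proof.
rewrite mulrAC mulrC ler_pM2l ?invr_gt0//; apply: le_trans (sum_cell_mass_le _ _ _) _.
by rewrite ler_wpM2r ?mass_ge0// ler_nat (leq_trans (leq_pred _))// (leq_trans (leq_pred _)).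
Qed.

Lemma hit_cell_le y z a : a%:R / M%:R <= z <= a.+1%:R / M%:R ->
  hit (z - y) <= hit_upper y a.
Proof.
move=> /andP[za zb]; rewrite /hit_upper sum_cell_mass; apply: hit_le; first by rewrite lerD2r.
rewrite addrAC ltrD2r; apply: le_lt_trans (lerD zb (lexx eps)) _.
have /andP[_ h] := windowP.
rewrite -addSnnS natrD mulrDl ltrD2l ltr_pdivlMr ?ltr0n//.
Qed.

Lemma hit_cell_ge y z a : a%:R / M%:R <= z <= a.+1%:R / M%:R ->
  hit_lower y a <= hit (z - y).
Proof.
(* For [window < 2] the truncated [window.-2] leaves an empty sum. Otherwise the run ends at
   [(a + window.-1) / M], which is at most [z + eps]. *)
move=> /andP[za zb]; rewrite /hit_lower; have [w2|w2] := leqP 2 window; last first.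
  have -> : window.-2 = 0%N by rewrite -subn2; apply/eqP; rewrite subn_eq0 ltnW.
  by rewrite big_ord0 mulr0 hit_ge0.
rewrite sum_cell_mass; apply: hit_ge; first by rewrite lerD2r.
rewrite addrAC lerD2r; apply: le_trans (lerD za (lexx eps)).
have /andP[h _] := windowP.
have -> : (a.+1 + window.-2 = a + window.-1)%N by lia.
by rewrite natrD mulrDl lerD2l ler_pdivrMr ?ltr0n.
Qed.

(** Since [window - 1 <= eps * M], at most two cells too many are counted; this is the relative
    error O(1/(eps M)) of the overview. *)
Lemma window_upper : window.+1%:R / (eps * M%:R) <= 1 + 2 / (eps * M%:R).
Proof.
have /andP[h _] := windowP; have em : 0 < eps * M%:R by rewrite mulr_gt0// ltr0n.
rewrite -[X in X + _](@divff _ (eps * M%:R)) ?gt_eqF// -mulrDl ler_pM2r ?invr_gt0//.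
by move: h => /=; rewrite -[window.+1]addn2 natrD; lra.
Qed.

Lemma window_lower : 1 - 2 / (eps * M%:R) <= window.-2%:R / (eps * M%:R).
Proof.
have /andP[_ h] := windowP; have em : 0 < eps * M%:R by rewrite mulr_gt0// ltr0n.
rewrite -[X in X - _](@divff _ (eps * M%:R)) ?gt_eqF// -mulrBl ler_pM2r ?invr_gt0//.
(* This also holds when [window.-2] is truncated to 0. *)
have : (window <= window.-2 + 2)%N by lia.
by rewrite -(ler_nat R) natrD; lra.
Qed.

End periodic_set.

(** * Averages over grid cells *)

(* A lower bound on the weights suffices: since they sum to 1, the upper estimate for W
   is the lower estimate for B - W. *)
Lemma weighted_average_bounds (R : realFieldType) (I : finType) (q W : I -> R) (D B : R) :
  (0 < #|I|)%N -> \sum_i q i = 1 -> (forall i, #|I|%:R^-1 - D <= q i) ->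
  0 <= D -> (forall i, 0 <= W i <= B) ->
  `|\sum_i q i * W i - #|I|%:R^-1 * \sum_i W i| <= #|I|%:R * D * B.
Proof.
move=> I0 q1 qD D0 WB.
have I0' : (#|I|%:R : R) != 0 by rewrite pnatr_eq0 -lt0n.
have lower (V : I -> R) : (forall i, 0 <= V i <= B) ->
    #|I|%:R^-1 * \sum_i V i - #|I|%:R * D * B <= \sum_i q i * V i.
  move=> VB.
  have -> : #|I|%:R * D * B = \sum_(i : I) D * B by rewrite sumr_const -[RHS]mulr_natl mulrA.
  rewrite mulr_sumr -sumrB; apply: ler_sum => i _.
  have /andP[v0 vB] := VB i.
  apply: (@le_trans _ _ ((#|I|%:R^-1 - D) * V i)); last exact: ler_wpM2r.
  by rewrite mulrBl lerD2l lerN2 ler_wpM2l.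
have := lower _ WB.
have /lower : forall i, 0 <= B - W i <= B by move=> i; have := WB i; lra.
under [X in _ <= X -> _]eq_bigr => i _ do rewrite mulrBr.
rewrite !sumrB sumr_const -mulr_suml q1 mul1r mulrBr -[B *+ _]mulr_natl mulKf//.
rewrite ler_norml; lra.
Qed.

Section cell_average.
Context {R : realFieldType} {d M N : nat}.
Variable c : 'I_N -> {ffun 'I_d -> 'I_M}.
Hypothesis N0 : (0 < N)%N.
Hypothesis M0 : (0 < M)%N.
Variable D : R.
Hypothesis D0 : 0 <= D.
Hypothesis cD : forall g, (M ^ d)%N%:R^-1 - D <= #|[pred k | c k == g]|%:R / N%:R.

(** Grouping the indices [k] by product cell turns the mean into a weighted average over all [M ^ d]
    cells. By distributivity, the product of the one-dimensional means is the unweighted average of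
    the same function. *)
Lemma cell_average (U : 'I_d -> 'I_M -> R) (K : R) : (forall i a, 0 <= U i a <= K) ->
  `|N%:R^-1 * \sum_k \prod_i U i (c k i) - \prod_i (M%:R^-1 * \sum_a U i a)|
  <= (M ^ d)%N%:R * D * K ^+ d.
Proof.
move=> UK.
have cardE : #|{ffun 'I_d -> 'I_M}| = (M ^ d)%N by rewrite card_ffun !card_ord.
pose W (g : {ffun 'I_d -> 'I_M}) := \prod_i U i (g i).
pose q g : R := #|[pred k | c k == g]|%:R / N%:R.
have NN : (N%:R : R) != 0 by rewrite pnatr_eq0 -lt0n.
have qE (V : {ffun 'I_d -> 'I_M} -> R) : \sum_g q g * V g = N%:R^-1 * \sum_k V (c k).
  rewrite (partition_big c xpredT)//= mulr_sumr; apply: eq_bigr => g _.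
  rewrite (eq_bigr (fun=> V g)); last by move=> k /eqP ->.
  rewrite sumr_const /q -[V g *+ _]mulr_natl mulrA; congr (_ * _).
  by rewrite mulrC.
have -> : \prod_i (M%:R^-1 * \sum_a U i a) = #|{ffun 'I_d -> 'I_M}|%:R^-1 * \sum_g W g.
  rewrite big_split/= prodr_const card_ord bigA_distr_bigA/= cardE natrX exprVn.
  by [].
rewrite -(qE W) -cardE; apply: weighted_average_bounds => //.
- by rewrite cardE expn_gt0 M0.
- under eq_bigr => g _ do rewrite -[q g]mulr1.
  by rewrite (qE (fun=> 1)) sumr_const card_ord mulVf.
- by move=> g; rewrite cardE; exact: cD.
move=> g; rewrite /W prodr_ge0/=; last by move=> i _; have /andP[] := UK i (g i).
by rewrite -[d in leRHS]card_ord -prodr_const; apply: ler_prod.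
Qed.

End cell_average.

(** * Lebesgue measure on tuples and discrepancy *)

Lemma measurable_tuple_prod (R : realType) (d : nat) (S : 'I_d -> set R) :
  (forall i, measurable (S i)) ->
  measurable [set t : d.-tuple R | forall i, S i (tnth t i)].
Proof.
move=> mS.
rewrite (_ : [set _ | _] = \bigcap_(i in [set: 'I_d])
    ((fun t : d.-tuple R => tnth t i) @^-1` S i)); last first.
  by apply/seteqP; split => [t h i _|t h i]; [exact: h|exact: (h i I)].
apply: fin_bigcap_measurable => [|i _]; first exact: finite_finset.
by rewrite -[X in measurable X]setTI; exact: measurable_tnth.
Qed.

(** Induction along the recursive definition: the first coordinate splits off as a factor of a
    product measure, and in dimension 0 the empty product is the unit mass. *)
Lemma lebesgue_tuple_prod (R : realType) (d : nat) (S : 'I_d -> set R) :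
  (forall i, measurable (S i)) ->
  lebesgue_tuple d [set t | forall i, S i (tnth t i)] = (\prod_i lebesgue_measure (S i))%E.
Proof.
elim: d S => [|d ih] S mS.
  rewrite big_ord0 /=.
  rewrite (_ : [set _ | _] = setT); last by apply/seteqP; split => // t _ [].
  by rewrite /= diracE in_setT.
rewrite big_ord_recl/= -ih//.
have mT := @measurable_tuple_prod R d (fun i => S (lift ord0 i)) (fun i => mS _).
transitivity ((lebesgue_measure \x lebesgue_tuple d)%E
  (S ord0 `*` [set t | forall i : 'I_d, S (lift ord0 i) (tnth t i)])); last first.
  by rewrite product_measure1E//; exact: mS.
rewrite /lebesgue_cons /pushforward /=.
congr product_measure1; apply/seteqP; split => -[x t] /=.
  move=> h; split; first by have := h ord0; rewrite tnth0.
  by move=> i; have := h (lift ord0 i); rewrite tnthS.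
move=> [h0 h] i; case: (unliftP ord0 i) => [j ->|->]; last by rewrite tnth0.
by rewrite tnthS.
Qed.

Lemma lebesgue_tuple_fin_prod (R : realType) (d : nat) (S : 'I_d -> set R) (v : 'I_d -> R) :
  (forall i, measurable (S i)) -> (forall i, lebesgue_measure (S i) = (v i)%:E) ->
  lebesgue_tuple d [set t | forall i, S i (tnth t i)] = (\prod_i v i)%:E.
Proof.
move=> mS Sv; rewrite lebesgue_tuple_prod// -prodEFin.
by apply: eq_bigr => i _; exact: Sv.
Qed.

Lemma lebesgue_tuple_box (R : realType) (d : nat) (a b : d.-tuple R) :
  (forall i, tnth a i <= tnth b i) ->
  lebesgue_tuple d (box a b) = (\prod_i (tnth b i - tnth a i))%:E.
Proof.
move=> ab; have := @lebesgue_tuple_fin_prod R d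
  (fun i => `[tnth a i, tnth b i[%classic) (fun i => tnth b i - tnth a i).
rewrite (_ : [set _ | _] = box a b).
  apply=> // i; rewrite lebesgue_measure_itv/= lte_fin lt_neqAle ab andbT.
  by case: eqP => /= [->|_]; rewrite ?subrr// EFinB.
by apply/seteqP; split => t /= h i; have := h i; rewrite in_itv/=.
Qed.

Lemma measurable_box (R : realType) (d : nat) (a b : d.-tuple R) : measurable (box a b).
Proof.
rewrite (_ : box a b = [set t | forall i, (`[tnth a i, tnth b i[%classic : set R) (tnth t i)]).
  by apply: (@measurable_tuple_prod R d (fun i => `[tnth a i, tnth b i[%classic)) => i.
by apply/seteqP; split => t /= h i; have := h i; rewrite in_itv/=.
Qed.

Section discrepancy_bounds.
Context {R : realType} {d : nat}.

Let half_open_cubeE : @half_open_cube R d = box (nseq_tuple d 0) (nseq_tuple d 1).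
Proof.
by apply/seteqP; split => t /= h i; have := h i; rewrite !tnth_nseq.
Qed.

Lemma discrepancy_ge (x : nat -> d.-tuple R) (N : nat) (a b : d.-tuple R) :
  box a b `<=` half_open_cube ->
  `|(count_in x N (box a b))%:R / N%:R - fine (lebesgue_tuple d (box a b))| <= discrepancy x N.
Proof.
move=> ab; apply: ub_le_sup; last by exists (a, b).
(* The family has to be bounded above for its supremum to dominate its members; 1 works because both
   the proportion and the volume lie in [[0, 1]]. *)
exists 1 => _ [[a' b'] /= h <-].
have count1 : 0 <= ((count_in x N (box a' b'))%:R / N%:R : R) <= 1.
  rewrite divr_ge0//=.
  (* For [N = 0] the quotient is 0 by the convention on inverses. *)
  have [->|N0] := posnP N; first by rewrite invr0 mulr0 ler01.
  rewrite ler_pdivrMr ?ltr0n// mul1r ler_nat (leq_trans (max_card _))//.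
  by rewrite card_ord.
have vol1 : 0 <= fine (lebesgue_tuple d (box a' b')) <= 1.
  rewrite fine_ge0//=.
  have : (lebesgue_tuple d (box a' b') <= 1%:E)%E.
    apply: (@le_trans _ _ (lebesgue_tuple d half_open_cube)).
      apply: le_measure; rewrite ?inE//; first exact: measurable_box.
      by rewrite half_open_cubeE; exact: measurable_box.
    rewrite half_open_cubeE lebesgue_tuple_box => [|i]; last by rewrite !tnth_nseq.
    by rewrite big1// => i _; rewrite !tnth_nseq subr0.
  move=> h1; rewrite -lee_fin fineK// ge0_fin_numE//.
  by rewrite (le_lt_trans h1)// ltry.
rewrite ler_norml; lra.
Qed.

Lemma discrepancy_ge0 (x : nat -> d.-tuple R) (N : nat) : 0 <= discrepancy x N.
Proof.
apply: le_trans (@discrepancy_ge x N (nseq_tuple d 0) (nseq_tuple d 1) _) => //.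
by rewrite -half_open_cubeE.
Qed.

End discrepancy_bounds.

Section grid_cell.
Context {R : realType} {d : nat}.
Variable M : nat.

(* The minimum puts the endpoint r = 1 in the last cell. *)
Definition grid_index (r : R) : 'I_M.+1 := inord (minn (Num.truncn (r * M.+1%:R)) M).

Lemma grid_indexP (r : R) : 0 <= r <= 1 ->
  (grid_index r)%:R / M.+1%:R <= r <= (grid_index r).+1%:R / M.+1%:R.
Proof.
move=> /andP[r0 r1]; rewrite /grid_index inordK ?ltnS ?geq_minr//.
have rM : 0 <= r * M.+1%:R by rewrite mulr_ge0.
rewrite ler_pdivrMr ?ltr0n// ler_pdivlMr ?ltr0n//.
apply/andP; split.
  apply: le_trans (_ : (Num.truncn (r * M.+1%:R))%:R <= _); rewrite ?ler_nat ?geq_minl//.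
  by rewrite truncn_le.
have [h|h] := leqP (Num.truncn (r * M.+1%:R)) M; first by rewrite ltW ?truncnS_gt.
by rewrite ler_piMl.
Qed.

Lemma grid_index_eq (r : R) (a : 'I_M.+1) :
  a%:R / M.+1%:R <= r < a.+1%:R / M.+1%:R -> grid_index r = a.
Proof.
rewrite ler_pdivrMr ?ltr0n// ltr_pdivlMr ?ltr0n// => h.
have aM : (a <= M)%N by rewrite -ltnS.
by rewrite /grid_index (truncn_def h) (minn_idPl aM) inord_val.
Qed.

Definition grid_cell (t : d.-tuple R) : {ffun 'I_d -> 'I_M.+1} := [ffun i => grid_index (tnth t i)].

(** Each half-open grid box lies inside its grid cell and is a test box of the discrepancy. Points
    with a coordinate equal to 1 belong to a cell but to no such box, so the comparison of counts is
    one-sided. *)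
Lemma grid_cell_count (x : nat -> d.-tuple R) (N : nat) (g : {ffun 'I_d -> 'I_M.+1}) :
  (M.+1 ^ d)%N%:R^-1 - discrepancy x N <=
  #|[pred k : 'I_N | grid_cell (x k) == g]|%:R / N%:R.
Proof.
pose a := [tuple ((g i)%:R / M.+1%:R : R) | i < d].
pose b := [tuple ((g i).+1%:R / M.+1%:R : R) | i < d].
have aE i : tnth a i = (g i)%:R / M.+1%:R by rewrite tnth_mktuple.
have bE i : tnth b i = (g i).+1%:R / M.+1%:R by rewrite tnth_mktuple.
have ab i : tnth a i <= tnth b i by rewrite aE bE ler_wpM2r// ler_nat.
have sub : box a b `<=` half_open_cube.
  move=> t /= h i; have := h i; rewrite aE bE => /andP[h1 h2]; apply/andP; split.
    by rewrite (le_trans _ h1)// divr_ge0.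
  by rewrite (lt_le_trans h2)// ler_pdivrMr ?ltr0n// mul1r ler_nat.
have := discrepancy_ge x N sub; rewrite lebesgue_tuple_box//=.
have -> : \prod_i (tnth b i - tnth a i) = (M.+1 ^ d)%N%:R^-1 :> R.
  rewrite (eq_bigr (fun=> M.+1%:R^-1)); last first.
    by move=> i _; rewrite aE bE -mulrBl -natrB// subSnn mul1r.
  by rewrite prodr_const card_ord natrX exprVn.
rewrite ler_norml => /andP[h _].
have cnt : (count_in x N (box a b))%:R / N%:R <=
    #|[pred k : 'I_N | grid_cell (x k) == g]|%:R / N%:R :> R.
  rewrite ler_wpM2r// ler_nat; apply: subset_leq_card; apply/fintype.subsetP => k.
  rewrite !inE => h'; apply/eqP/ffunP => i; rewrite ffunE; apply: grid_index_eq.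
  by have := h' i; rewrite aE bE.
lra.
Qed.

End grid_cell.

Lemma low_discrepancy_cvg0 (R : realType) (d : nat) (x : nat -> d.-tuple R) :
  low_discrepancy x -> discrepancy x N @[N --> \oo] --> 0.
Proof.
move=> /eqO_exP[k /= k0 xk]; apply/cvgr0Pnorm_le => e e0.
(* Chosen so that [ln N >= C] makes the final bound [k * (d + 1)! / ln N] at most [e]. *)
pose C := (k * d.+1`!%:R / e).
have C0 : 0 < C by rewrite divr_gt0// mulr_gt0// ltr0n fact_gt0.
near=> N.
have NC : expR C <= N%:R by near: N; exact: nbhs_infty_ger.
have N0 : 0 < N%:R :> R by exact: lt_le_trans (expR_gt0 _) NC.
have lnN : C <= ln N%:R by rewrite -(expRK C) ler_ln// posrE expR_gt0.
have ln0 : 0 < ln N%:R :> R by exact: lt_le_trans lnN.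
have xN : `|discrepancy x N| <= k * `|N%:R^-1 * ln N%:R ^+ d| by near: N.
apply: (le_trans xN); rewrite ger0_norm; last first.
  by rewrite mulr_ge0 ?invr_ge0 ?exprn_ge0// ltW.
(* One more power of [ln N] than needed is still O(N). *)
have h : ln N%:R ^+ d.+1 <= d.+1`!%:R * N%:R :> R.
  rewrite -ler_pdivrMl ?ltr0n ?fact_gt0// mulrC.
  have := expR_ge1Dxn d (ltW ln0); rewrite lnK ?posrE//; lra.
have h2 : N%:R^-1 * ln N%:R ^+ d <= d.+1`!%:R / ln N%:R :> R.
  by rewrite ler_pdivlMr// -mulrA -exprSr ler_pdivrMl// mulrC.
apply: le_trans (ler_wpM2l (ltW k0) h2) _.
by rewrite mulrA ler_pdivrMr// [leRHS]mulrC -ler_pdivrMr.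
Unshelve. all: by end_near. Qed.

(** * Averages of hitting lengths along the sequence *)

Section hit_average.
Context {R : realType} {d : nat}.
Variables (z : nat -> d.-tuple R) (z_cube : forall n, closed_cube (z n)).
Variables (eps : R) (eps0 : 0 < eps) (delta : R) (delta_itv : 0 <= delta < 2^-1).

Definition near_int : set R := [set r | dist_int r <= delta].

Lemma measurable_near_int : measurable near_int.
Proof.
rewrite (_ : near_int = setT `&` (@dist_int R) @^-1` `]-oo, delta]%classic).
  by apply: measurable_dist_int => //.
by apply/seteqP; split => r /=; rewrite in_itv//= => -[].
Qed.

Lemma near_intD (x : R) (k : int) : near_int (x + k%:~R) <-> near_int x.
Proof. by rewrite /near_int /= dist_intD. Qed.

Lemma mass_near_int : mass near_int (- 2^-1) 2^-1 = 2 * delta.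
Proof.
rewrite /mass dist_int_ball// lebesgue_measure_itv/= lte_fin.
case/andP: delta_itv => d0 _; case: ltP => h /=; lra.
Qed.

Let mA := measurable_near_int.
Let pA := near_intD.
Variable M : nat.

Let cell k := grid_cell M (z k).
Let w := window M.+1 eps.
Let K : R := (w.+1%:R / eps * (2 * delta)) ^+ d.

(** This bounds the excluded term [k = l]: for fixed [M], [K] is of order [delta ^+ d]. *)
Lemma prod_hit_le (k : nat) (y : 'I_d -> R) :
  \prod_i hit near_int eps (tnth (z k) i - y i) <= K.
Proof.
rewrite /K -[d in leRHS]card_ord -prodr_const; apply: ler_prod => i _.
rewrite hit_ge0//= -mass_near_int.
apply: le_trans (hit_upper_le mA pA (ltn0Sn M) eps0 (y i) (cell k i)).
by apply: hit_cell_le => //; rewrite ffunE;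
    exact: (grid_indexP M (z_cube k i)).
Qed.

Variables (N : nat) (N0 : (0 < N)%N).

Let err : R := (M.+1 ^ d)%N%:R * discrepancy z N * K.

(** Each factor lies between step functions of the grid cell of [z k]; [cell_average] evaluates the
    mean of both products. The bounds do not depend on [y]. *)
Lemma hit_average (y : 'I_d -> R) :
  (w.-2%:R / (eps * M.+1%:R) * (2 * delta)) ^+ d - err <=
  N%:R^-1 * \sum_(k < N) \prod_i hit near_int eps (tnth (z k) i - y i) <=
  (w.+1%:R / (eps * M.+1%:R) * (2 * delta)) ^+ d + err.
Proof.
have average := @cell_average R d M.+1 N (fun k => cell k) N0 (ltn0Sn M) (discrepancy z N)
  (discrepancy_ge0 z N) (fun g => grid_cell_count z N g).
have N0' : 0 <= N%:R^-1 :> R by rewrite invr_ge0.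
apply/andP; split.
  have /average : forall i (a : 'I_M.+1),
      0 <= hit_lower near_int M.+1 eps (y i) a <= w.+1%:R / eps * (2 * delta).
    by move=> i a; rewrite hit_lower_ge0//= -mass_near_int hit_lower_le.
  under [X in `|_ - X|]eq_bigr => i _ do rewrite sum_hit_lower// mass_near_int.
  rewrite prodr_const card_ord -/w -/K -/err ler_norml => /andP[h _].
  apply: (@le_trans _ _ (N%:R^-1 *
      \sum_(k < N) \prod_i hit_lower near_int M.+1 eps (y i) (cell k i))).
    by move: h; lra.
  rewrite ler_wpM2l//; apply: ler_sum => k _; apply: ler_prod => i _.
  by rewrite hit_lower_ge0//=; apply: hit_cell_ge => //; rewrite ffunE;
    exact: (grid_indexP M (z_cube k i)).
have /average : forall i (a : 'I_M.+1),
    0 <= hit_upper near_int M.+1 eps (y i) a <= w.+1%:R / eps * (2 * delta).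
  by move=> i a; rewrite hit_upper_ge0//= -mass_near_int hit_upper_le.
under [X in `|_ - X|]eq_bigr => i _ do rewrite sum_hit_upper// mass_near_int.
rewrite prodr_const card_ord -/w -/K -/err ler_norml => /andP[_ h].
apply: (@le_trans _ _ (N%:R^-1 *
    \sum_(k < N) \prod_i hit_upper near_int M.+1 eps (y i) (cell k i))).
  rewrite ler_wpM2l//; apply: ler_sum => k _; apply: ler_prod => i _.
  by rewrite hit_ge0//=; apply: hit_cell_le => //; rewrite ffunE;
    exact: (grid_indexP M (z_cube k i)).
by move: h; lra.
Qed.

End hit_average.

(** * Probability that two perturbed points are close *)

(** On rectangles the joint law factors by independence, so it is the product measure, which
    integrates the measures of sections. The variable conditioned on, [X l], comes first. *)
Lemma independent_pair_law {disp disp' : measure_display} {T : measurableType disp}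
    {T' : measurableType disp'} {R : realType} (P : probability T R)
    (X : nat -> {RV P >-> T'}) (k l : nat) (D : set (T' * T')) :
  independent_RVs X -> k != l -> measurable D ->
  P ((fun w => (X l w, X k w)) @^-1` D) =
  (\int[distribution P (X l)]_x distribution P (X k) (xsection D x))%E.
Proof.
move=> indep kl mD.
have mXX : measurable_fun [set: T] (fun w => (X l w, X k w)) by exact: measurable_fun_pair.
pose joint : {measure set (T' * T') -> \bar R} :=
  measure_function_pushforward__canonical__measure_function_Measure P mXX.
suff prodE : forall B C, measurable B -> measurable C ->
    joint (B `*` C) = (distribution P (X l) B * distribution P (X k) C)%E.
  by transitivity (joint D) => //; rewrite -(product_measure_unique prodE mD).
move=> B C mB mC.
have := indep [fset l; k]%fset (fun j => if j == k then C else B).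
rewrite big_fsetU1 ?inE 1?eq_sym// big_seq_fset1 eqxx [k == l]eq_sym.
rewrite eq_sym (negbTE kl) /= => <-.
  congr (P _); apply/seteqP; split => w /=.
    by move=> [Bw Cw] j /=; rewrite !inE => /orP[] /eqP ->; rewrite ?eqxx// eq_sym (negbTE kl).
  move=> h; split.
    by have := h l; rewrite /= !inE eqxx/= eq_sym (negbTE kl); apply.
  by have := h k; rewrite /= !inE eqxx orbT; apply.
by move=> j _; case: ifP.
Qed.

Section pair_probability.
Context {R : realType} {d : nat} {disp : measure_display} {T : measurableType disp}
  (P : probability T R).
Variables (X : nat -> {RV P >-> d.-tuple R}) (X_indep : independent_RVs X).
Hypothesis X_unif : forall n, uniform_on_cube (X n).
Variables (eps delta : R) (delta0 : 0 <= delta) (z : nat -> d.-tuple R).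

(** The first component stands for [X l] and the second for [X k]. The terms are grouped so that
    fixing the first leaves the form [t + eps * u] of [hit]; fractional parts are dropped because
    [dist_int] is 1-periodic. *)
Definition close_pairs (k l : nat) : set (d.-tuple R * d.-tuple R) :=
  [set p | forall i, near_int delta
    (tnth (z k) i - (tnth (z l) i + eps * tnth p.1 i) + eps * tnth p.2 i)].

Lemma measurable_close_pairs k l : measurable (close_pairs k l).
Proof.
pose f i (p : d.-tuple R * d.-tuple R) :=
  tnth (z k) i - (tnth (z l) i + eps * tnth p.1 i) + eps * tnth p.2 i.
rewrite (_ : close_pairs k l = \bigcap_(i in [set: 'I_d]) (f i @^-1` near_int delta)); last first.
  by apply/seteqP; split => [t h i _|t h i]; [exact: h|exact: (h i I)].
apply: fin_bigcap_measurable => [|i _]; first exact: finite_finset.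
rewrite -[X in measurable X]setTI.
suff : measurable_fun [set: d.-tuple R * d.-tuple R] (f i).
  by apply => //; exact: measurable_near_int.
apply: measurable_funD; last first.
  apply: measurable_funM => //.
  by apply: (measurableT_comp (measurable_tnth i)) => //; exact: measurable_snd.
apply: measurable_funB => //; apply: measurable_funD => //; apply: measurable_funM => //.
by apply: (measurableT_comp (measurable_tnth i)) => //; exact: measurable_fst.
Qed.

Lemma torus_dist_close_pairs k l w :
  torus_dist (frac_shift eps (z k) (X k w)) (frac_shift eps (z l) (X l w)) <= delta <->
  close_pairs k l (X l w, X k w).
Proof.
have E i : dist_int (tnth (frac_shift eps (z k) (X k w)) i - tnth (frac_shift eps (z l) (X l w)) i)
    = dist_int (tnth (z k) i - (tnth (z l) i + eps * tnth (X l w) i) + eps * tnth (X k w) i).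
  rewrite !tnth_mktuple /frac_part.
  set a := tnth (z k) i + _; set b := tnth (z l) i + _.
  (* Taking fractional parts changes the difference by the integer [floor b - floor a]. *)
  rewrite -[RHS](dist_intD _ (Num.floor b - Num.floor a)) intrB; congr dist_int.
  by rewrite /a /b; ring.
split.
  by move=> /bigmax_leP[_ h] i; rewrite /near_int/= -E; exact: h.
by move=> h; apply/bigmax_leP; split => // i _; rewrite E; exact: h.
Qed.

(** Once [X l = x] is fixed, the condition separates over the coordinates of [X k], so its part in
    the cube is a product set. *)
Lemma section_close_pairs k l (x : d.-tuple R) :
  distribution P (X k) (xsection (close_pairs k l) x) =
  (\prod_i hit (near_int delta) eps (tnth (z k) i - (tnth (z l) i + eps * tnth x i)))%:E.
Proof.
rewrite X_unif; last by apply: measurable_xsection; exact: measurable_close_pairs.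
pose S i := [set u | near_int delta (tnth (z k) i - (tnth (z l) i + eps * tnth x i) + eps * u)
  /\ 0 <= u <= 1].
rewrite -(@lebesgue_tuple_fin_prod _ _ S); first last.
- by move=> i; rewrite /S lebesgue_hit//; exact: measurable_near_int.
- move=> i; rewrite (_ : S i = ((fun u => tnth (z k) i - (tnth (z l) i + eps * tnth x i) + eps * u)
      @^-1` near_int delta) `&` `[0, 1]%classic); last first.
    by apply/seteqP; split => u /=; rewrite in_itv.
  apply: measurableI => //; rewrite -[X in measurable X]setTI.
  have /(_ measurableT _ (measurable_near_int delta)) : measurable_fun [set: R]
    (fun u => tnth (z k) i - (tnth (z l) i + eps * tnth x i) + eps * u); last by [].
  by apply: measurable_funD => //; exact: measurable_funM.
congr (lebesgue_tuple d _); apply/seteqP; split => t /=.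
  by rewrite /xsection/= => -[]; rewrite inE => h h' i; split; [exact: h|exact: h'].
move=> h; split; last by move=> i; have [] := h i.
by rewrite /xsection/= inE => i; have [] := h i.
Qed.

End pair_probability.

(** * Bounds on the expectation *)

Lemma probability_integral_bounds (disp : measure_display) (T : measurableType disp)
    (R : realType) (P : probability T R) (f : T -> \bar R) (L U : R) :
  measurable_fun [set: T] f -> (forall x, 0 <= f x)%E ->
  (forall x, L%:E <= f x)%E -> (forall x, f x <= U%:E)%E ->
  (L%:E <= \int[P]_x f x <= U%:E)%E.
Proof.
move=> mf f0 fL fU; apply/andP; split.
  (* [L] may be negative, while the comparison of integrals is between nonnegative functions. *)
  apply: (@le_trans _ _ (\int[P]_x (Num.max 0 L)%:E)%E).
    by rewrite integral_cst//= probability_setT mule1 lee_fin le_max lexx orbT.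
  apply: ge0_le_integral => //.
  - by move=> x _; rewrite lee_fin le_max lexx.
  - by move=> x _; rewrite maxEle; case: ifP.
have U0 x : (0 <= U%:E :> \bar R)%E := le_trans (f0 x) (fU x).
apply: (@le_trans _ _ (\int[P]_x U%:E)%E); last by rewrite integral_cst//= probability_setT mule1.
by apply: ge0_le_integral => // x _; exact: U0.
Qed.

Section expectation_bounds.
Context {R : realType} {d : nat} {disp : measure_display} {T : measurableType disp}
  (P : probability T R).
Variables (X : nat -> {RV P >-> d.-tuple R}) (X_indep : independent_RVs X).
Hypothesis X_unif : forall n, uniform_on_cube (X n).
Variables (eps delta : R) (delta0 : 0 <= delta) (z : nat -> d.-tuple R).
Variables (N : nat) (N0 : (0 < N)%N) (L U C : R).

Let hits k (y : 'I_d -> R) := \prod_i hit (near_int delta) eps (tnth (z k) i - y i).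

Hypothesis hits_avg : forall y, L <= N%:R^-1 * \sum_(k < N) hits k y <= U.
Hypothesis hits_le : forall k y, hits k y <= C.

Let pairs : pred ('I_N * 'I_N) := fun kl => kl.1 != kl.2.
Let event (kl : 'I_N * 'I_N) : set T :=
  (fun w => (X kl.2 w, X kl.1 w)) @^-1` close_pairs eps delta z kl.1 kl.2.

Let measurable_event kl : measurable (event kl).
Proof.
rewrite -[X in measurable X]setTI.
have : measurable_fun [set: T] (fun w => (X kl.2 w, X kl.1 w)) by exact: measurable_fun_pair.
by apply => //; exact: measurable_close_pairs.
Qed.

(** Conditionally on [X l], the sum over all [k] is controlled by [hits_avg], and the missing term
    [k = l] lies between 0 and [C]. *)
Let sum_event (l : 'I_N) :
  ((N%:R * L - C)%:E <= \sum_(k < N | k != l) P (event (k, l)) <= (N%:R * U)%:E)%E.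
Proof.
have NN : (N%:R : R) != 0 by rewrite pnatr_eq0 -lt0n.
have NR0 : 0 < N%:R :> R by rewrite ltr0n.
pose y (x : d.-tuple R) i := tnth (z l) i + eps * tnth x i.
pose sect (k : 'I_N) x := distribution P (X k) (xsection (close_pairs eps delta z k l) x).
have -> : (\sum_(k < N | k != l) P (event (k, l)) =
    \int[distribution P (X l)]_x \sum_(k < N | k != l) sect k x)%E.
  under [in RHS]eq_integral => x _ do rewrite -big_filter.
  rewrite ge0_integral_sum//; last first.
    by move=> k; apply: measurable_fun_xsection; exact: measurable_close_pairs.
  rewrite big_filter; apply: eq_bigr => k kl; apply: independent_pair_law => //.
  exact: measurable_close_pairs.
have sumE x : (\sum_(k < N | k != l) sect k x = (\sum_(k < N | k != l) hits k (y x))%:E)%E.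
  rewrite -sumEFin; apply: eq_bigr => k _; rewrite /sect section_close_pairs//.
have hits_split x : \sum_(k < N | k != l) hits k (y x) = \sum_(k < N) hits k (y x) - hits l (y x).
  by rewrite [in RHS](bigD1 l)//= addrAC subrr add0r.
have hits_ge0 k x : 0 <= hits k (y x) by apply: prodr_ge0 => i _; exact: hit_ge0.
apply: probability_integral_bounds.
- under eq_fun do rewrite -big_filter.
  apply: emeasurable_sum => k.
  by apply: measurable_fun_xsection; exact: measurable_close_pairs.
- by move=> x; apply: sume_ge0.
- move=> x; rewrite sumE lee_fin hits_split.
  have /andP[h _] := hits_avg (y x); rewrite -(ler_pM2l NR0) mulrA divff// mul1r in h.
  have := hits_le l (y x); lra.
- move=> x; rewrite sumE lee_fin hits_split.
  have /andP[_ h] := hits_avg (y x); rewrite -(ler_pM2l NR0) mulrA divff// mul1r in h.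
  have := hits_ge0 l x; lra.
Qed.

Lemma expectation_close_pairs_bounds :
  ((N%:R * L - C)%:E <=
   'E_P[fun w => (#|[pred kl : 'I_N * 'I_N | (kl.1 != kl.2) &&
      (torus_dist (frac_shift eps (z kl.1) (X kl.1 w)) (frac_shift eps (z kl.2) (X kl.2 w))
       <= delta)]|%:R / N%:R)%R]
   <= (N%:R * U)%:E)%E.
Proof.
have NN : (N%:R : R) != 0 by rewrite pnatr_eq0 -lt0n.
rewrite unlock.
have cardE w : #|[pred kl : 'I_N * 'I_N | (kl.1 != kl.2) &&
      (torus_dist (frac_shift eps (z kl.1) (X kl.1 w)) (frac_shift eps (z kl.2) (X kl.2 w))
       <= delta)]|%:R = \sum_(kl | pairs kl) \1_(event kl) w :> R.
  rewrite -sum1_card natr_sum big_mkcondr/=; apply: eq_bigr => kl _.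
  rewrite indicE; have [h|h] := boolP (w \in event kl).
    by rewrite inE in h; move/(torus_dist_close_pairs X eps delta0 z) : h => ->.
  by case: ifPn => // /(torus_dist_close_pairs X eps delta0 z); rewrite notin_setE in h.
under eq_integral => w _ do rewrite cardE mulrC EFinM -sumEFin -big_filter.
rewrite ge0_integralZl//; first last.
- by move=> w _; apply: sume_ge0 => kl _; rewrite lee_fin.
- by apply: emeasurable_sum => kl; apply/measurable_EFinP; exact: measurable_indic.
rewrite ge0_integral_sum//; last first.
  by move=> kl; apply/measurable_EFinP; exact: measurable_indic.
rewrite big_filter.
under eq_bigr => kl _ do rewrite integral_indic// setIT.
(* Grouping by the index [l] conditioned on makes [sum_event] applicable; its bounds are independent
   of [l], so the mean over [l] preserves them. *)
have -> : (\sum_(kl | pairs kl) P (event kl) =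
    \sum_(l < N) \sum_(k < N | k != l) P (event (k, l)))%E.
  by rewrite (exchange_big_dep xpredT)//= pair_big_dep/=; apply: eq_big => [[k l]|[k l]].
have cst c : (N%:R^-1%:E * \sum_(l < N) c%:E = c%:E :> \bar R)%E.
  by rewrite sumEFin -EFinM sumr_const card_ord -[c *+ _]mulr_natl mulKf.
rewrite -(cst (N%:R * L - C)) -(cst (N%:R * U)).
by apply/andP; split; apply: lee_wpmul2l; rewrite ?lee_fin ?invr_ge0//;
  apply: lee_sum => l _; case/andP: (sum_event l).
Qed.

End expectation_bounds.

(** * Limits and the scaling of the radius *)

Lemma cvge_near_bounds (R : realType) (u : nat -> \bar R) (a : R) :
  (forall e, 0 < e -> \forall n \near \oo, ((a - e)%:E <= u n <= (a + e)%:E)%E) ->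
  u n @[n --> \oo] --> a%:E.
Proof.
(* Real bounds on both sides force finiteness, which reduces the claim to convergence in [R]. *)
move=> ua; have fin_u x e : ((a - e)%:E <= x <= (a + e)%:E)%E -> x \is a fin_num.
  by move=> /andP[h1 h2]; rewrite fin_numElt (lt_le_trans (ltNyr _) h1) (le_lt_trans h2 (ltry _)).
apply/fine_cvgP; split.
  by near=> n; apply: (fin_u _ 1); near: n; exact: ua.
apply/cvgrPdist_le => e e0; near=> n => /=.
have h : ((a - e)%:E <= u n <= (a + e)%:E)%E by near: n; exact: ua.
move: (h); rewrite -(fineK (fin_u _ _ h)) !lee_fin => /andP[h1 h2].
by rewrite ler_norml; lra.
Unshelve. all: by end_near. Qed.

Lemma near_pow1 (R : realType) (d : nat) (c e : R) : 0 < e ->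
  \forall M \near \oo, `|1 - (1 + c / M.+1%:R) ^+ d| <= e.
Proof.
move=> e0; have h : (1 + c / M.+1%:R) ^+ d @[M --> \oo] --> (1 : R).
  rewrite [X in _ --> X](_ : 1 = (1 + c * 0) ^+ d :> R); last by rewrite mulr0 addr0 expr1n.
  apply: (cvg_comp _ (fun x : R => x ^+ d)); last exact: exprn_continuous.
  by apply: cvgD; [exact: cvg_cst|apply: cvgM; [exact: cvg_cst|exact: cvg_harmonic]].
by move/cvgrPdist_le : h; apply.
Qed.

Lemma radius_pow (R : realType) (d N : nat) (s : R) : (0 < d)%N -> (0 < N)%N ->
  N%:R * (2 * (s / (N%:R `^ d%:R^-1))) ^+ d = (2 * s) ^+ d.
Proof.
move=> d0 N0; have dN : (d%:R : R) != 0 by rewrite pnatr_eq0 -lt0n.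
have NN : (N%:R : R) != 0 by rewrite pnatr_eq0 -lt0n.
rewrite mulrA exprMn exprVn -[(_ `^ _) ^+ _]powR_mulrn ?powR_ge0// -powRrM mulVf// powRr1//.
by rewrite mulrCA divff// mulr1.
Qed.

(** A radius of at least [1/2] would give [N <= N * (2 * delta) ^+ d = (2 * s) ^+ d], which fails
    for large [N]. *)
Lemma radius_small (R : realType) (d : nat) (s : R) : (0 < d)%N -> 0 < s ->
  \forall N \near \oo, 0 <= s / (N%:R `^ d%:R^-1) < 2^-1.
Proof.
move=> d0 s0; near=> N.
have N0 : (0 < N)%N by near: N; exists 1%N.
have NS : (2 * s) ^+ d + 1 <= N%:R by near: N; exact: nbhs_infty_ger.
set delta := s / _.
have delta0 : 0 <= delta by rewrite divr_ge0 ?powR_ge0// ltW.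
rewrite delta0/= ltNge; apply/negP => h.
have := radius_pow s d0 N0; rewrite -/delta => E.
have h1 : 1 <= (2 * delta) ^+ d by rewrite exprn_ege1//; lra.
have : N%:R <= N%:R * (2 * delta) ^+ d by rewrite ler_peMr.
by rewrite E; lra.
Unshelve. all: by end_near. Qed.

Theorem proposition1p3 (R : realType) (d : nat) (d_ge1 : (1 <= d)%N)
    (z : nat -> d.-tuple R) (z_cube : forall n, closed_cube (z n))
    (z_low : low_discrepancy z) (eps : R) (eps_gt0 : 0 < eps)
    (disp : measure_display) (T : measurableType disp) (P : probability T R)
    (X : nat -> {RV P >-> d.-tuple R}) (X_indep : independent_RVs X)
    (X_unif : forall n, uniform_on_cube (X n)) (s : R) (s_gt0 : 0 < s) :
  let Y := fun (w : T) (n : nat) => frac_shift eps (z n) (X n w) in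
  'E_P[fun w => pair_correlation (Y w) N s]%E @[N --> \oo]
    --> ((2 * s) ^+ d)%:E.
Proof.
move=> Y; apply: cvge_near_bounds => e e0.
set A := (2 * s) ^+ d; have A0 : 0 < A by rewrite exprn_gt0// mulr_gt0.
(* Two relative errors [e1], one from the grid and one from [N], add up to [2 * A * e1 = e]. *)
pose e1 := e / (2 * A).
have e10 : 0 < e1 by rewrite divr_gt0// mulr_gt0.
have Ae1 : A * e1 = e / 2 by rewrite /e1; field; rewrite gt_eqF.
(* The grid is fixed before [N]. The last condition allows the lower bound on [al] to be raised to
   the power [d]. *)
have [M [M_up M_low M_ge]] : exists M : nat,
    [/\ (1 + 2 / (eps * M.+1%:R)) ^+ d <= 1 + e1,
        1 - e1 <= (1 - 2 / (eps * M.+1%:R)) ^+ d & 0 <= 1 - 2 / (eps * M.+1%:R)].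
  near \oo => M; exists M; split.
  - have : `|1 - (1 + 2 / eps / M.+1%:R) ^+ d| <= e1 by near: M; exact: near_pow1.
    by rewrite ler_norml invfM mulrA; lra.
  - have : `|1 - (1 + - (2 / eps) / M.+1%:R) ^+ d| <= e1 by near: M; exact: near_pow1.
    by rewrite ler_norml invfM mulrA mulNr; lra.
  have : 2 / eps <= M%:R by near: M; exact: nbhs_infty_ger.
  rewrite ler_pdivrMr// => h; rewrite subr_ge0 ler_pdivrMr ?mulr_gt0// mul1r.
  by rewrite mulrC (le_trans h)// ler_pM2r// ler_nat.
set w := window M.+1 eps.
pose kappa := w.+1%:R / eps.
have kappa0 : 0 <= kappa ^+ d by rewrite exprn_ge0// divr_ge0// ltW.
(* With [M] fixed, these are the discrepancy error and the excluded diagonal term, both relative to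
   [A]. *)
have small : \forall N \near \oo,
    (M.+1 ^ d)%N%:R * kappa ^+ d * discrepancy z N + kappa ^+ d * N%:R^-1 <= e1.
  have /cvgr0Pnorm_le/(_ e1 e10) h : (M.+1 ^ d)%N%:R * kappa ^+ d * discrepancy z n
      + kappa ^+ d * (n%:R^-1 : R) @[n --> \oo] --> (0 : R).
    rewrite [X in _ --> X](_ : 0 =
        (M.+1 ^ d)%N%:R * kappa ^+ d * 0 + kappa ^+ d * 0 :> R); last by rewrite !mulr0 addr0.
    apply: cvgD; apply: cvgM; try exact: cvg_cst; first exact: low_discrepancy_cvg0.
    by rewrite -(cvg_shiftS (fun n => n%:R^-1 : R)); exact: cvg_harmonic.
  by near=> N; apply: le_trans (ler_norm _) _; near: N.
near=> N.
have small_N : (M.+1 ^ d)%N%:R * kappa ^+ d * discrepancy z N + kappa ^+ d * N%:R^-1 <= e1.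
  by near: N.
have N0 : (0 < N)%N by near: N; exists 1%N.
have : 0 <= s / (N%:R `^ d%:R^-1) < 2^-1 by near: N; exact: radius_small.
set delta := s / _ => delta_itv; have [delta0 _] := andP delta_itv.
have scale : N%:R * (2 * delta) ^+ d = A by exact: radius_pow.
have NN : 0 < N%:R :> R by rewrite ltr0n.
have avg := @hit_average R d z z_cube eps eps_gt0 delta delta_itv M N N0.
have up := prod_hit_le z_cube eps_gt0 delta_itv M.
have := expectation_close_pairs_bounds X_indep X_unif delta0 N0 avg up.
have alpha := window_lower (ltn0Sn M) eps_gt0.
have beta := window_upper (ltn0Sn M) eps_gt0.
rewrite -/w in alpha beta *.
set al := w.-2%:R / _ in alpha *; set be := w.+1%:R / (eps * _) in beta *.
have ald : 1 - e1 <= al ^+ d.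
  by apply: (le_trans M_low); apply: lerXn2r; rewrite ?nnegrE// (le_trans M_ge).
have be0 : 0 <= be by rewrite divr_ge0// mulr_ge0// ltW.
have bed : be ^+ d <= 1 + e1.
  apply: le_trans M_up; apply: lerXn2r; rewrite ?nnegrE//.
  exact: le_trans beta.
rewrite -/kappa !(exprMn _ al) !(exprMn _ be) !(exprMn _ kappa).
move: scale small_N ald bed kappa0.
set q := (2 * delta) ^+ d; set D := discrepancy z N.
set k := kappa ^+ d; set m := (_ ^ _)%N%:R => scale small_N ald bed k0.
have mkD0 : 0 <= m * k * D by rewrite mulr_ge0 ?discrepancy_ge0// mulr_ge0.
have kN0 : 0 <= k * N%:R^-1 by rewrite mulr_ge0// invr_ge0.
(* This turns all terms into multiples of [A]: [N] times the averaging error is [A * (m * k * D)],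
   and the diagonal term [k * q] is [A * (k / N)]. *)
have qE : q = A * N%:R^-1 by rewrite -scale mulrAC divff ?mul1r// gt_eqF.
move=> /andP[h1 h2]; apply/andP; split.
  apply: le_trans h1; rewrite lee_fin.
  have -> : N%:R * (al ^+ d * q - m * D * (k * q)) - k * q
      = A * (al ^+ d - (m * k * D + k * N%:R^-1)).
    by rewrite qE; field; rewrite gt_eqF.
  apply: (@le_trans _ _ (A * (1 - e1 - e1))); first lra.
  by rewrite ler_pM2l//; lra.
apply: (le_trans h2); rewrite lee_fin.
have -> : N%:R * (be ^+ d * q + m * D * (k * q)) = A * (be ^+ d + m * k * D).
  by rewrite qE; field; rewrite gt_eqF.
apply: (@le_trans _ _ (A * (1 + e1 + e1))); last lra.
by rewrite ler_pM2l//; lra.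
Unshelve. all: by end_near. Qed.
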